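(* Let $s_0,s_f,v_0,v_f\in\mathbb{R}$. For each $\alpha>0$ let $u_\alpha\in W^{1,1}([0,1];\mathbb{R})$ be the (unique) optimal control of the problem (Ptv) of minimizing $$\frac12\int_0^1 u(t)^2\,dt+\alpha\,\mathrm{TV}(u)$$ over $u\in W^{1,1}([0,1];\mathbb{R})$ and states $x_1,x_2$ subject to $\dot x_1(t)=x_2(t)$, $\dot x_2(t)=u(t)$ on $[0,1]$, $x_1(0)=s_0$, $x_1(1)=s_f$, $x_2(0)=v_0$, $x_2(1)=v_f$. Then the asymptotic optimal control as $\alpha\to\infty$ is unique and is piecewise constant with a single switching at $t=1/2$: namely, for every $t\in[0,1]\setminus\{1/2\}$, $\lim_{\alpha\to\infty}u_\alpha(t)=u_\infty(t)$, where $$u_\infty(t)=\begin{cases}4(s_f-s_0)-v_f-3v_0, & 0\le t<1/2,\\ 3v_f+v_0-4(s_f-s_0), & 1/2\le t\le 1.\end{cases}$$ Consequently, the asymptotic optimal total variation is $$\mathrm{TV}(u_\infty)=4\,\big|2(s_f-s_0)-v_f-v_0\big|.$$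
   Context: For $u:[0,1]\to\mathbb{R}$ (not necessarily continuous), the total variation is $\mathrm{TV}(u)=\sup\sum_{i=1}^N|u(\tau_i)-u(\tau_{i-1})|$, the supremum being over all partitions $0=\tau_0<\tau_1<\dots<\tau_N=1$; for absolutely continuous $u$ it equals $\int_0^1|\dot u(t)|\,dt$. The ''asymptotic optimal control as $\alpha\to\infty$'' means the limit of the optimal controls $u_\alpha$ as $\alpha\to\infty$; the states $x_1,x_2$ are absolutely continuous. *)

(* Defs.v *)
From HB Require Import structures.
From mathcomp Require Import all_boot all_order all_algebra.
From mathcomp Require Import all_classical all_reals all_analysis.

Set Implicit Arguments.
Unset Strict Implicit.
Unset Printing Implicit Defensive.

Import Order.TTheory GRing.Theory Num.Theory.
Import numFieldNormedType.Exports.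

Local Open Scope classical_set_scope.
Local Open Scope ring_scope.

(* A function on [a, b] is encoded as a total function R -> R whose values
   outside [a, b] are never inspected.  An element of W^{1,1}([a, b]) is
   identified with its absolutely continuous representative; this is the one
   whose pointwise values and total variation are meant. *)
Definition absolutely_continuous (R : realType) (a b : R) (f : R -> R) : Prop :=
  forall e : R, 0 < e -> exists2 d : R, 0 < d &
    forall (n : nat) (l r : 'I_n -> R),
      (forall i, a <= l i /\ l i <= r i /\ r i <= b) ->
      trivIset [set: 'I_n] (fun i => `]l i, r i[%classic) ->
      \sum_(i < n) (r i - l i) < d ->
      \sum_(i < n) `|f (r i) - f (l i)| < e.

(* The derivative relative to A, hence one-sided at the endpoints of an
   interval A. *)
Definition has_derivative_within (R : realType) (A : set R) (f : R -> R)
    (t l : R) : Prop :=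
  (f s - f t) / (s - t) @[s --> within A t^'] --> l.

Definition trajectory (R : realType) (s0 sf v0 vf : R) (u x1 x2 : R -> R) : Prop :=
  [/\ absolutely_continuous 0 1 x1 /\ absolutely_continuous 0 1 x2,
      forall t, t \in `[0, 1] -> has_derivative_within `[0, 1] x1 t (x2 t),
      forall t, t \in `[0, 1] -> has_derivative_within `[0, 1] x2 t (u t),
      x1 0 = s0 /\ x1 1 = sf
    & x2 0 = v0 /\ x2 1 = vf].

Definition admissible (R : realType) (s0 sf v0 vf : R) (u : R -> R) : Prop :=
  absolutely_continuous 0 1 u /\
  exists x1 x2 : R -> R, trajectory s0 sf v0 vf u x1 x2.

Definition cost (R : realType) (alpha : R) (u : R -> R) : \bar R :=
  ((2^-1)%:E * \int[lebesgue_measure]_(t in `[0%R, 1%R]) (u t ^+ 2)%:E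
   + alpha%:E * total_variation 0%R 1%R u)%E.

Definition optimal_control (R : realType) (s0 sf v0 vf alpha : R)
    (u : R -> R) : Prop :=
  admissible s0 sf v0 vf u /\
  forall w : R -> R, admissible s0 sf v0 vf w -> (cost alpha u <= cost alpha w)%E.

Definition u_infty (R : realType) (s0 sf v0 vf : R) (t : R) : R :=
  if t < 2^-1 then 4 * (sf - s0) - vf - 3 * v0
  else 3 * vf + v0 - 4 * (sf - s0).

(* Main.v *)
Require Import Defs.
From HB Require Import structures.
From mathcomp Require Import all_boot all_order all_algebra.
From mathcomp Require Import all_classical all_reals all_analysis.
From mathcomp Require Import ring lra.

Import Order.TTheory GRing.Theory Num.Theory.
Import numFieldNormedType.Exports.

Local Open Scope classical_set_scope.
Local Open Scope ring_scope.

(* With D = (v0 + vf)/2 - (sf - s0), admissibility of u forces the two moments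
   int u = vf - v0 and int (t - 1/2) u = D.  The optimal control is
   u(t) = (vf - v0) + c clamp_h(t - 1/2), where clamp_h truncates to [-h, h]:
   the second moment reads c (h/4 - h^3/3) = D, and optimality reads
   |c| (1/2 - h)^2 = 2 alpha (if D = 0 then u is constant and c = h = 0).
   To see that it is optimal, let w be admissible and phi = w - u.  By the
   moments, u may be replaced in int u phi by u - (vf - v0) - c (t - 1/2)
   = c (q(t) - q(1 - t)) with q(t) = (1/2 - h - t)^+, so
   int u phi = c int q(t) (phi(t) - phi(1 - t)) dt, and
   |w(1 - t) - w(t)| <= TV(w), with equality for u on the support of q, gives
   int u phi + alpha (TV(w) - TV(u)) >= 0.  Hence
   cost w >= cost u + 1/2 int phi^2, which also gives uniqueness.  Finally
   h = O(1/alpha), so that c h -> 4 D as alpha -> oo. *)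

Set Implicit Arguments.
Unset Strict Implicit.
Unset Printing Implicit Defensive.

(** * Real analysis on an interval: absolute continuity, one-sided derivatives, antiderivatives of
    absolute values *)

Section calculus.
Context {R : realType}.
Implicit Types (a b t l : R) (f g F : R -> R).
Local Notation mu := (@lebesgue_measure R).

Lemma absolutely_continuous_within a b f :
  absolutely_continuous a b f -> {within `[a, b], continuous f}.
Proof.
move=> acf; apply/subspace_continuousP => t /=; rewrite in_itv/= => /andP[at_ tb].
apply/cvgrPdist_lt => e e0; have [d d0 fd] := acf e e0.
near=> s.
have : s \in `[a, b] by near: s; exact: withinT.
rewrite in_itv/= => /andP[as_ sb].
have std : `|t - s| < d.
  by near: s; apply: cvg_within; exact: nbhsx_ballx.
(* Absolute continuity is applied to a single interval; [Num.min] and [Num.max] order its ends,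
   since [s] may lie on either side of [t]. *)
have := fd 1%N (fun=> Num.min t s) (fun=> Num.max t s).
rewrite !big_ord1; case: (leP t s) => ts.
- move/(_ (fun=> conj at_ (conj ts sb))).
  rewrite distrC; apply.
    by move=> i j _ _ _; rewrite (ord1 i) (ord1 j).
  by rewrite -normrN opprB ger0_norm ?subr_ge0// in std.
- move/(_ (fun=> conj as_ (conj (ltW ts) tb))); apply.
    by move=> i j _ _ _; rewrite (ord1 i) (ord1 j).
  by rewrite ger0_norm ?subr_ge0 ?ltW// in std.
Unshelve. all: by end_near. Qed.

Lemma lipschitz_absolutely_continuous a b f (K : R) :
  (forall s t, a <= s -> s <= t -> t <= b -> `|f t - f s| <= K * (t - s)) ->
  absolutely_continuous a b f.
Proof.
move=> fK e e0; have K1 : 0 < `|K| + 1 by rewrite ltr_wpDl.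
exists (e / (`|K| + 1)); first exact: divr_gt0.
move=> n x y xy _; rewrite ltr_pdivlMr// mulrC; apply: le_lt_trans.
rewrite mulr_sumr; apply: ler_sum => i _; have [ax [xyi yb]] := xy i.
apply: le_trans (fK _ _ ax xyi yb) _; apply: ler_wpM2r; first by rewrite subr_ge0.
by rewrite (le_trans (ler_norm K))// lerDl.
Qed.

Lemma is_derive_has_derivative_within (A : set R) f t l :
  is_derive t 1 f l -> has_derivative_within A f t l.
Proof.
move=> fl; apply: cvg_within_filter.
have : h^-1 *: ((f \o shift t) (h *: (1:R)) - f t) @[h --> 0^'] --> l.
  by have [+ <-] := fl.
move=> /cvgrPdist_lt H; apply/cvgrPdist_lt => e e0.
have := H e e0; rewrite !near_withinE !near_simpl => -[d /= d0 Hd].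
exists d => // s /= ts st.
have := Hd (s - t); rewrite /= sub0r normrN distrC => /(_ ts).
by rewrite subr_eq0 => /(_ st) /=; rewrite scaler1 subrK [X in _ -> `|_ - X| < _]mulrC.
Qed.

Lemma has_derivative_within_is_derive a b f t l : t \in `]a, b[ ->
  has_derivative_within `[a, b] f t l -> is_derive t 1 f l.
Proof.
move=> tab fl; suff : h^-1 *: ((f \o shift t) (h *: (1:R)) - f t) @[h --> 0^'] --> l.
  by move=> H; split; [apply/cvg_ex; exists l|exact: cvg_lim].
move/cvgrPdist_lt in fl; apply/cvgrPdist_lt => e e0.
have := fl e e0; rewrite !near_withinE !near_simpl => -[d /= d0 Hd].
have [r /= r0 Hr] := near_in_itvoo tab.
(* The radius [r] keeps [h + t] inside the open interval, where the relative and the two-sided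
   difference quotients agree. *)
exists (Num.min d r) => [|h /=]; first by rewrite /= lt_min d0.
rewrite sub0r normrN lt_min => /andP[hd hr] h0.
have th : ball t d (h + t) by rewrite /ball/= opprD addrCA subrr addr0 normrN.
have thr : ball t r (h + t) by rewrite /ball/= opprD addrCA subrr addr0 normrN.
have hneq : h + t != t by rewrite -subr_eq0 addrK.
have := Hd _ th hneq (subset_itv_oo_cc (Hr _ thr)).
by rewrite /= addrK scaler1 mulrC.
Qed.

Lemma FTC_has_derivative_within a b f F : a < b ->
  {within `[a, b], continuous f} -> {within `[a, b], continuous F} ->
  (forall t, t \in `]a, b[ -> is_derive t 1 F (f t)) ->
  \int[mu]_(t in `[a, b]) f t = F b - F a.
Proof.
move=> ab cf cF dF; rewrite /Rintegral (continuous_FTC2 (F := F) ab cf)//.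
  have [_ Fa Fb] := (continuous_within_itvP F ab).1 cF.
  by split=> // t tab; have [] := dF t tab.
by move=> t tab; rewrite derive1E; have [] := dF t tab.
Qed.

(** If [f t0 > 0], continuity keeps [f] above [f t0 / 2] on a nondegenerate interval around [t0],
    and the integral is then positive. *)
Lemma continuous_Rintegral_eq0 f : {within `[0, 1], continuous f} ->
  (forall t, t \in `[0, 1] -> 0 <= f t) -> \int[mu]_(t in `[0, 1]) f t = 0 ->
  forall t, t \in `[0, 1] -> f t = 0.
Proof.
move=> cf f0 If t0 t01; apply/eqP/negP => /negP ft0.
have e0 : 0 < f t0 / 2 by rewrite divr_gt0// lt_neqAle eq_sym ft0 f0.
have intf : mu.-integrable `[0, 1] (EFin \o f).
  by apply: continuous_compact_integrable => //; exact: segment_compact.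
have /integrableP[mf _] := intf.
have If0 : (\int[mu]_(t in `[0%R, 1%R]) (f t)%:E = 0)%E.
  by rewrite -[LHS]fineK ?integrable_fin_num// [fine _]If.
have := (subspace_continuousP _ _).1 cf t0 t01.
move/cvgrPdist_lt => /(_ _ e0); rewrite near_withinE => -[d /= d0 Hd].
move: (t01); rewrite in_itv/= => /andP[t00 t01'].
(* Clipping to [0, 1] leaves [a < b] even when [t0] is an endpoint; the half radius puts the closed
   interval inside the open ball. *)
pose a := Num.max 0 (t0 - d / 2); pose b := Num.min 1 (t0 + d / 2).
have ab : a < b by rewrite gt_max !lt_min; apply/andP; split; apply/andP; split; lra.
have abd s : s \in `[a, b] -> s \in `[0, 1] /\ f t0 / 2 <= f s.
  rewrite in_itv/= ge_max le_min => /andP[/andP[s0 sd] /andP[s1 ds]].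
  have s01 : s \in `[0, 1] by rewrite in_itv/= s0.
  have st0 : ball_ Num.norm t0 d s by rewrite /= ltr_distlC; apply/andP; split; lra.
  have : `|f t0 - f s| < f t0 / 2 := Hd s st0 s01.
  by rewrite ltr_distlC => /andP[]; split=> //; lra.
suff : (0 < \int[mu]_(t in `[0%R, 1%R]) (f t)%:E)%E by rewrite If0 ltxx.
apply: (@lt_le_trans _ _ (\int[mu]_(t in `[a, b]) (f t0 / 2)%:E)%E).
  rewrite integral_cst//= lebesgue_measure_itv/= lte_fin ab -EFinB -EFinM lte_fin.
  by rewrite mulr_gt0// subr_gt0.
apply: (@le_trans _ _ (\int[mu]_(t in `[a, b]) (f t)%:E)%E).
  apply: ge0_le_integral => //=.
  - by move=> s _; rewrite lee_fin ltW.
  - by apply: measurable_funS mf => // s /abd[].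
  - by move=> s /abd[_ ?]; rewrite lee_fin.
apply: ge0_subset_integral => //=.
by move=> s /abd[].
Qed.

(** Proves differentiability from one global inequality, so that the kink of an absolute value needs
    no separate limit argument. *)
Lemma quadratic_remainder_is_derive f t l (K : R) :
  (forall s, `|f s - f t - l * (s - t)| <= K * (s - t) ^+ 2) -> is_derive t 1 f l.
Proof.
move=> fK; suff : h^-1 *: ((f \o shift t) (h *: (1:R)) - f t) @[h --> 0^'] --> l.
  by move=> H; split; [apply/cvg_ex; exists l|exact: cvg_lim].
apply/cvgrPdist_lt => e e0; rewrite near_withinE near_simpl.
have K1 : 0 < `|K| + 1 by rewrite ltr_wpDl.
exists (e / (`|K| + 1)) => [|h /=]; first exact: divr_gt0.
rewrite sub0r normrN ltr_pdivlMr// => he h0.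
have := fK (h + t); rewrite addrK scaler1 => fh.
have -> : l - h^-1 *: (f (h + t) - f t) = - (h^-1 * (f (h + t) - f t - l * h)).
  by rewrite /GRing.scale/=; field.
rewrite normrN normrM normfV mulrC ltr_pdivrMr ?normr_gt0//.
apply: le_lt_trans fh _; rewrite -real_normK ?num_real// expr2 mulrA ltr_pM2r ?normr_gt0//.
by apply: le_lt_trans he; rewrite mulrC ler_wpM2l// (le_trans (ler_norm _))// lerDl.
Qed.

(** For [s] and [t] of equal sign the remainder is exactly (s - t)^2 up to sign; for opposite signs,
    s t <= 0 bounds it by (s - t)^2. *)
Lemma is_derive_mul_norm t : is_derive t 1 (fun y : R => y * `|y|) (2 * `|t|).
Proof.
apply: (@quadratic_remainder_is_derive _ _ _ 1) => s; rewrite mul1r ler_norml.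
have st2 := sqr_ge0 (s - t); have s2 := sqr_ge0 s; have t2 := sqr_ge0 t.
case: (ler0P s) => hs; case: (ler0P t) => ht.
- by apply/andP; split; lra.
- have st : s * t <= 0 by rewrite mulr_le0_ge0// ?ltW.
  by apply/andP; split; lra.
- have st : s * t <= 0 by rewrite mulr_ge0_le0// ?ltW.
  by apply/andP; split; lra.
- by apply/andP; split; lra.
Qed.

Lemma is_derive_mul_norm_shift a t :
  is_derive t 1 (fun y : R => (y + a) * `|y + a|) (2 * `|t + a|).
Proof.
have H := @is_derive_mul_norm (t + a).
have K : is_derive t 1 (fun y : R => y + a) 1.
  by apply: is_derive_eq; rewrite addr0.
by have := @is_derive1_comp _ _ (fun y => y + a) t _ _ H K; rewrite mulr1.
Qed.

Lemma is_derive_norm3_shift a t :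
  is_derive t 1 (fun y : R => (y + a) * ((y + a) * `|y + a|))
    (3 * ((t + a) * `|t + a|)).
Proof.
have H := @is_derive_mul_norm_shift a t.
have K : is_derive t 1 (fun y : R => y + a) 1.
  by apply: is_derive_eq; rewrite addr0.
by apply: is_derive_eq; rewrite /GRing.scale/=; ring.
Qed.

Lemma is_derive_within_continuous (A : set R) f F :
  (forall t, is_derive t 1 F (f t)) -> {within A, continuous F}.
Proof.
move=> dF; apply: continuous_subspaceT => t.
by apply/differentiable_continuous/derivable1_diffP; have [] := dF t.
Qed.

Lemma is_derive_lipschitz a b f F (K : R) : (forall t, is_derive t 1 F (f t)) ->
  (forall t, a <= t -> t <= b -> `|f t| <= K) ->
  forall s t, a <= s -> s <= t -> t <= b -> `|F t - F s| <= K * (t - s).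
Proof.
move=> dF fK s t as_ st tb.
have [|z zst ->] := MVT_segment st (fun x _ => dF x).
  exact: is_derive_within_continuous dF.
rewrite normrM (ger0_norm (_ : 0 <= t - s)) ?subr_ge0//.
rewrite ler_wpM2r ?subr_ge0//; apply: fK.
  by rewrite (le_trans as_)// (itvP zst).
by rewrite (le_trans _ tb)// (itvP zst).
Qed.

Lemma within_continuousM (A : set R) f g :
  {within A, continuous f} -> {within A, continuous g} ->
  {within A, continuous (fun t => f t * g t)}.
Proof. by move=> cf cg t; apply: continuousM; [exact: cf|exact: cg]. Qed.

Lemma within_continuous_reflect f : {within `[0, 1], continuous f} ->
  {within `[0, 1], continuous (fun t => f (1 - t))}.
Proof.
move=> /subspace_continuousP cf; apply/subspace_continuousP => t /= t01.
have t01' : 1 - t \in `[0, 1].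
  by move: t01; rewrite !in_itv/= => /andP[? ?]; apply/andP; split; lra.
have /cvgrPdist_lt ft := cf _ t01'; apply/cvgrPdist_lt => e /ft.
rewrite !near_withinE => -[d /= d0 Hd]; exists d => // s /= ts s01.
apply: Hd.
  by rewrite /= distrC (_ : 1 - s - (1 - t) = t - s)//; ring.
by move: s01; rewrite /= !in_itv/= => /andP[? ?]; apply/andP; split; lra.
Qed.

Lemma within_continuous_integrable a b f : {within `[a, b], continuous f} ->
  mu.-integrable `[a, b] (EFin \o f).
Proof. by move=> cf; apply: continuous_compact_integrable => //; exact: segment_compact. Qed.

End calculus.

(** * The boundary conditions as two moment constraints on the control *)

Section moments.
Context {R : realType}.
Local Notation mu := (@lebesgue_measure R).

Lemma admissible_moments s0 sf v0 vf u : admissible s0 sf v0 vf u ->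
  \int[mu]_(t in `[0, 1]) u t = vf - v0 /\
  \int[mu]_(t in `[0, 1]) (t * u t) = vf - (sf - s0).
Proof.
move=> [/absolutely_continuous_within cu [x1 [x2 [[/absolutely_continuous_within c1
  /absolutely_continuous_within c2] d1 d2 [x10 x11] [x20 x21]]]]].
have dx1 (t : R) : t \in `]0, 1[ -> is_derive t 1 x1 (x2 t).
  move=> t01; apply: (has_derivative_within_is_derive t01); apply: d1.
  exact: subset_itv_oo_cc t01.
have dx2 (t : R) : t \in `]0, 1[ -> is_derive t 1 x2 (u t).
  move=> t01; apply: (has_derivative_within_is_derive t01); apply: d2.
  exact: subset_itv_oo_cc t01.
have cid : {within `[0, 1], continuous (fun t : R => t)}.
  by apply: continuous_subspaceT => t; exact: cvg_id.
split; first by rewrite (FTC_has_derivative_within _ cu c2 dx2)// x20 x21.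
(* Integration by parts in one antiderivative: the terms [x2] cancel in F', leaving [t * u t]. *)
pose F (t : R) := t * x2 t - x1 t.
have dF (t : R) : t \in `]0, 1[ -> is_derive t 1 F (t * u t).
  move=> t01; have D1 := dx1 _ t01; have D2 := dx2 _ t01.
  by apply: is_derive_eq; rewrite /GRing.scale/=; ring.
rewrite (FTC_has_derivative_within _ _ _ dF)//.
- by rewrite /F x20 x21 x10 x11; ring.
- exact: within_continuousM.
- by apply: within_continuousB => //; exact: within_continuousM.
Qed.

End moments.

(** * The truncated linear control, its total variation and its minimality *)

Section optimality.
Context {R : realType}.
Local Notation mu := (@lebesgue_measure R).
Local Notation I f := (\int[mu]_(t in `[0, 1]) f t).

(** The positive part of [y], written with an absolute value so that y |y| supplies its
    antiderivative. *)
Definition ramp (y : R) := (`|y| + y) / 2.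

Definition clamp (h y : R) := (`|y + h| - `|y - h|) / 2.

Definition control (m c h t : R) := m + c * clamp h (t - 2^-1).

Lemma clampE (h y : R) : 0 <= h ->
  clamp h y = if y <= - h then - h else if y <= h then y else h.
Proof.
move=> h0; rewrite /clamp.
case: (lerP y (- h)) => yh.
  rewrite ler0_norm ?ler0_norm; [|lra..]; lra.
case: (lerP y h) => yh'.
  rewrite ger0_norm ?ler0_norm; [|lra..]; lra.
rewrite ger0_norm ?ger0_norm; [|lra..]; lra.
Qed.

Lemma clampN (h y : R) : clamp h (- y) = - clamp h y.
Proof.
by rewrite /clamp -normrN -(normrN (_ - h)) !opprD !opprK; field.
Qed.

Lemma clamp_nondecreasing (h x y : R) : 0 <= h -> x <= y -> clamp h x <= clamp h y.
Proof.
move=> h0 xy; rewrite !clampE//.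
by case: (lerP x (- h)); case: (lerP x h); case: (lerP y (- h)); case: (lerP y h) => *; lra.
Qed.

Lemma clamp_lipschitz (h x y : R) : 0 <= h -> x <= y ->
  clamp h y - clamp h x <= y - x.
Proof.
move=> h0 xy; rewrite !clampE//.
by case: (lerP x (- h)); case: (lerP x h); case: (lerP y (- h)); case: (lerP y h) => *; lra.
Qed.

(** Truncation corrects t - 1/2 by its excess beyond -h and beyond h. The two ramps are exchanged by
    t -> 1 - t, which later allows pairing values at t and 1 - t. *)
Lemma clamp_ramp (h t : R) :
  clamp h (t - 2^-1) = t - 2^-1 + ramp (2^-1 - h - t) - ramp (2^-1 - h - (1 - t)).
Proof.
rewrite /clamp /ramp -(normrN (_ + h)).
have -> : 2^-1 - h - (1 - t) = t - 2^-1 - h by field.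
have -> : 2^-1 - h - t = - (t - 2^-1 + h) by field.
by field.
Qed.

Lemma ramp_ge0 (y : R) : 0 <= ramp y.
Proof. by have := ler_norm (- y); rewrite /ramp normrN => ?; lra. Qed.

Lemma ramp_le0 (y : R) : y <= 0 -> ramp y = 0.
Proof. by move=> y0; rewrite /ramp ler0_norm// addNr mul0r. Qed.

Lemma continuous_ramp (a : R) : continuous (fun t => ramp (a - t)).
Proof.
move=> t; apply: cvgM; last exact: cvg_cst.
have H : (a - t0) @[t0 --> t] --> (a - t) by apply: cvgB; [exact: cvg_cst|exact: cvg_id].
by apply: cvgD => //; exact: cvg_norm.
Qed.

Lemma Rintegral_ramp (a : R) : 0 <= a <= 1 -> I (fun t => ramp (a - t)) = a ^+ 2 / 2.
Proof.
move=> /andP[a0 a1].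
(* An antiderivative of [ramp (a - t)] that vanishes for t >= a, so only F(0) = - a^2 / 2
   contributes. *)
pose F (t : R) := 4^-1 * ((t + - a) * `|t + - a| - (t - a) * (t - a)).
have dF (t : R) : is_derive t 1 F (ramp (a - t)).
  have D := @is_derive_mul_norm_shift R (- a) t.
  by apply: is_derive_eq; rewrite /GRing.scale/= /ramp distrC; field.
rewrite (FTC_has_derivative_within _ _ _ (fun t _ => dF t))//.
- rewrite /F (ger0_norm (_ : 0 <= 1 + - a)) ?subr_ge0//.
  by rewrite ler0_norm ?add0r ?oppr_le0//; field.
- exact/continuous_subspaceT/continuous_ramp.
- exact: is_derive_within_continuous dF.
Qed.

Lemma Rintegral_reflect (f : R -> R) : {within `[0, 1], continuous f} ->
  I f = I (fun t => f (1 - t)).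
Proof.
move=> cf.
have -> : I f = \int[mu]_(t in `[1 - 1, 1]) f (1 - t).
  by apply: Rintegration_by_substitution_onem => //; rewrite lexx ler01.
by rewrite subrr.
Qed.

(** The variation splits over [0, t], [t, 1 - t] and [1 - t, 1]; the middle piece already dominates
    the increment. *)
Lemma total_variation_reflect (w : R -> R) (t : R) : 0 <= t -> t <= 2^-1 ->
  (`|w (1 - t) - w t|%:E <= total_variation 0 1 w)%E.
Proof.
move=> t0 t1.
rewrite (@total_variationD _ 0 1 t)//; last lra.
rewrite (@total_variationD _ t 1 (1 - t))//; [|lra..].
apply: (le_trans (total_variation_ge w (_ : t <= 1 - t))); first lra.
apply: (@le_trans _ _ (total_variation t (1 - t) w + total_variation (1 - t) 1 w)%E).
  by rewrite leeDl// total_variation_ge0//; lra.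
by rewrite leeDr// total_variation_ge0//.
Qed.

Lemma control_continuous (m c h : R) : continuous (control m c h).
Proof.
move=> t; apply: cvgD; first exact: cvg_cst.
apply: cvgM; first exact: cvg_cst.
apply: cvgM; last exact: cvg_cst.
have H : t0 - 2^-1 @[t0 --> t] --> t - 2^-1 by apply: cvgB; [exact: cvg_id|exact: cvg_cst].
by apply: cvgB; apply: cvg_norm; [apply: cvgD|apply: cvgB] => //; exact: cvg_cst.
Qed.

(** Where the ramp is positive, the clamp is saturated at both t and 1 - t. The increment is then
    the whole signed variation 2 c h: the equality case of the reflected bound. *)
Lemma ramp_control (m c h t : R) : 0 <= h ->
  ramp (2^-1 - h - t) * (control m c h (1 - t) - control m c h t) =
  ramp (2^-1 - h - t) * (2 * c * h).
Proof.
move=> h0; have [th|th] := lerP (2^-1 - h) t.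
  by rewrite ramp_le0 ?subr_le0// !mul0r.
rewrite /control (_ : 1 - t - 2^-1 = - (t - 2^-1)); last by field.
by rewrite clampN clampE// (_ : t - 2^-1 <= - h); [ring|lra].
Qed.

Lemma total_variation_control (m c h : R) : 0 <= h <= 2^-1 ->
  total_variation 0 1 (control m c h) = (2 * `|c| * h)%:E.
Proof.
move=> /andP[h0 h1].
have H c' m' : 0 <= c' ->
    total_variation 0 1 (control m' c' h) = (2 * `|c'| * h)%:E.
  move=> c0; rewrite nondecreasing_total_variation//.
    rewrite ger0_norm// /control sub0r (_ : 1 - 2^-1 = 2^-1 :> R); last by field.
    rewrite clampN clampE//; congr (_%:E).
    by case: lerP => [|_]; [|case: lerP]; nra.
  move=> x y _ _ xy; rewrite /control lerD2l ler_wpM2l// clamp_nondecreasing//; lra.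
have [c0|c0] := lerP 0 c; first exact: H.
(* For c < 0 the control is decreasing; negating it reduces to the nondecreasing case. *)
rewrite -total_variationN -normrN -(H (- c) (- m)); last by rewrite oppr_ge0 ltW.
by congr total_variation; apply/funext => t; rewrite /control/=; ring.
Qed.

(** * Linearity of the integral on continuous functions, then the duality inequality *)

Lemma RintegralD_cont (f g : R -> R) :
  {within `[0, 1], continuous f} -> {within `[0, 1], continuous g} ->
  I (fun t => f t + g t) = I f + I g.
Proof. by move=> cf cg; rewrite RintegralD//; exact: within_continuous_integrable. Qed.

Lemma RintegralZl_cont (k : R) (f : R -> R) : {within `[0, 1], continuous f} ->
  I (fun t => k * f t) = k * I f.
Proof. by move=> cf; rewrite RintegralZl//; exact: within_continuous_integrable. Qed.

Lemma within_continuousZ (k : R) (f : R -> R) : {within `[0, 1], continuous f} ->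
  {within `[0, 1], continuous (fun t => k * f t)}.
Proof.
move=> cf; apply: within_continuousM => //.
by apply: continuous_subspaceT => t; exact: cvg_cst.
Qed.

Lemma within_continuous_sqr (f : R -> R) : {within `[0, 1], continuous f} ->
  {within `[0, 1], continuous (fun t => f t ^+ 2)}.
Proof.
move=> cf; rewrite (_ : (fun t => _) = (fun t => f t * f t)).
  exact: within_continuousM.
by apply/funext => t; rewrite expr2.
Qed.

(** The real [T] stands for TV(w), 2 |c| h is TV(u), and (1/2 - h)^2 / 2 is the integral of the
    weight [q]. *)
Lemma dual_lower_bound (m c h T : R) (w : R -> R) :
  let u := control m c h in
  0 <= h <= 2^-1 -> {within `[0, 1], continuous w} ->
  I w = I u -> I (fun t => t * w t) = I (fun t => t * u t) ->
  (forall t, 0 <= t -> t <= 2^-1 -> `|w (1 - t) - w t| <= T) ->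
  - `|c| * (T - 2 * `|c| * h) * ((2^-1 - h) ^+ 2 / 2) <= I (fun t => u t * (w t - u t)).
Proof.
move=> u /andP[h0 h1] cw I0 I1 wT.
pose phi (t : R) := w t - u t; pose q (t : R) := ramp (2^-1 - h - t).
have cid : {within `[0, 1], continuous (fun t : R => t)}.
  by apply: continuous_subspaceT => t; exact: cvg_id.
have cu : {within `[0, 1], continuous u} by apply/continuous_subspaceT/control_continuous.
have cphi : {within `[0, 1], continuous phi} by exact: within_continuousB.
have cq : {within `[0, 1], continuous q} by apply/continuous_subspaceT/continuous_ramp.
have cphi' := within_continuous_reflect cphi.
have cq' := within_continuous_reflect cq.
have ctw : {within `[0, 1], continuous (fun t => t * w t)} by exact: within_continuousM.
have ctu : {within `[0, 1], continuous (fun t => t * u t)} by exact: within_continuousM.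
have Iphi : I phi = 0.
  by rewrite RintegralB ?I0 ?subrr//; exact: within_continuous_integrable.
have Itphi : I (fun t => t * phi t) = 0.
  under eq_Rintegral do rewrite mulrBr.
  by rewrite RintegralB ?I1 ?subrr//; exact: within_continuous_integrable.
have cqphi := within_continuousM cq cphi.
have cqphi' := within_continuousM cq cphi'.
have cq'phi := within_continuousM cq' cphi.
have ctphi := within_continuousM cid cphi.
(* The affine part of [u] is isolated because the moment constraints annihilate it against [phi];
   only the two ramps remain. *)
have -> : I (fun t => u t * (w t - u t)) =
    I (fun t => (m - c * 2^-1) * phi t + c * (t * phi t)
                + (c * (q t * phi t) + - c * (q (1 - t) * phi t))).
  apply: eq_Rintegral => t _; rewrite -/(phi t) /u /control clamp_ramp -/(q t) -/(q (1 - t)).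
  by ring.
rewrite RintegralD_cont; last 2 first.
  by apply: within_continuousD; exact: within_continuousZ.
  by apply: within_continuousD; exact: within_continuousZ.
rewrite [X in _ <= X + _]RintegralD_cont ?RintegralZl_cont ?Iphi ?Itphi//; last 2 first.
  exact: within_continuousZ.
  exact: within_continuousZ.
rewrite !mulr0 addr0 add0r RintegralD_cont; last 2 first.
  exact: within_continuousZ.
  exact: within_continuousZ.
(* Reflecting the second ramp term puts both under the same weight [q t], against phi(t) - phi(1 -
   t). *)
rewrite !RintegralZl_cont// (Rintegral_reflect cq'phi).
under [X in _ <= _ + _ * X]eq_Rintegral do rewrite subKr.
rewrite -!RintegralZl_cont// -RintegralD_cont; [|exact: within_continuousZ..].
(* Turning the constant back into the integral of [q] reduces the claim to a pointwise
   comparison. *)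
rewrite -Rintegral_ramp; last by apply/andP; split; lra.
rewrite -RintegralZl_cont//; apply: le_Rintegral => //.
- exact/within_continuous_integrable/within_continuousZ.
- by apply: within_continuous_integrable; apply: within_continuousD; exact: within_continuousZ.
move=> t; rewrite /= in_itv/= => /andP[t0 t1]; rewrite -/(q t).
have -> : c * (q t * phi t) + - c * (q t * phi (1 - t)) =
    q t * (c * (w t - w (1 - t))) + c * (q t * (u (1 - t) - u t)).
  by rewrite /phi; ring.
rewrite ramp_control// -/(q t).
have [th|th] := lerP (2^-1 - h) t.
  by rewrite /q ramp_le0 ?subr_le0//; lra.
have : `|c * (w t - w (1 - t))| <= `|c| * T.
  by rewrite normrM distrC ler_wpM2l// wT//; lra.
rewrite ler_norml => /andP[cw0 _].
have q0 : 0 <= q t by exact: ramp_ge0.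
have c2 : `|c| * `|c| = c * c by rewrite -normrM ger0_norm// -expr2 sqr_ge0.
rewrite -subr_ge0.
have -> : q t * (c * (w t - w (1 - t))) + c * (q t * (2 * c * h)) -
    - `|c| * (T - 2 * `|c| * h) * q t =
    q t * (c * (w t - w (1 - t)) + `|c| * T) + 2 * h * q t * (c * c - `|c| * `|c|).
  by ring.
by rewrite c2 subrr mulr0 addr0 mulr_ge0//; lra.
Qed.

(** Expanding w^2 around [u] leaves the cross term [u * (w - u)]. When |c| (1/2 - h)^2 = 2 alpha,
    the dual bound makes it at least - alpha (T - 2 |c| h), the exact change in the variation
    term. *)
Lemma control_minimizes (m c h alpha T : R) (w : R -> R) :
  let u := control m c h in
  0 <= h <= 2^-1 -> {within `[0, 1], continuous w} ->
  I w = I u -> I (fun t => t * w t) = I (fun t => t * u t) ->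
  `|c| * (2^-1 - h) ^+ 2 <= 2 * alpha ->
  c * (2 * alpha - `|c| * (2^-1 - h) ^+ 2) = 0 ->
  (forall t, 0 <= t -> t <= 2^-1 -> `|w (1 - t) - w t| <= T) ->
  2^-1 * I (fun t => u t ^+ 2) + alpha * (2 * `|c| * h)
    + 2^-1 * I (fun t => (w t - u t) ^+ 2)
  <= 2^-1 * I (fun t => w t ^+ 2) + alpha * T.
Proof.
move=> u h01 cw I0 I1 ca ca0 wT; have := dual_lower_bound h01 cw I0 I1 wT; rewrite -/u.
have cu : {within `[0, 1], continuous u} by apply/continuous_subspaceT/control_continuous.
have cphi : {within `[0, 1], continuous (w - u)} by exact: within_continuousB.
have cuphi := within_continuousM cu cphi.
have -> : I (fun t => w t ^+ 2) = I (fun t => u t ^+ 2) + I (fun t => (w t - u t) ^+ 2)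
    + 2 * I (fun t => u t * (w t - u t)).
  have cu2 := within_continuous_sqr cu; have cphi2 := within_continuous_sqr cphi.
  rewrite -(RintegralZl_cont _ cuphi) -(RintegralD_cont cu2 cphi2) -RintegralD_cont.
  - by apply: eq_Rintegral => t _ /=; rewrite !fctE; ring.
  - exact: within_continuousD cu2 cphi2.
  - exact: within_continuousZ.
move: (I (fun t => u t ^+ 2)) (I (fun t => (w t - u t) ^+ 2))
  (I (fun t => u t * (w t - u t))) => A B C.
have T0 : 0 <= T by apply: le_trans (wT 0 _ _) => //; lra.
have a0 : 0 <= alpha.
  have : 0 <= `|c| * (2^-1 - h) ^+ 2 by rewrite mulr_ge0// sqr_ge0.
  by lra.
(* For c = 0 the control is constant and the dual bound is 0, so alpha T >= 0 suffices. *)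
have [->|cn0] := eqVneq c 0.
  rewrite normr0; have := mulr_ge0 a0 T0; lra.
have E : `|c| * (2^-1 - h) ^+ 2 = 2 * alpha.
  by move/eqP : ca0; rewrite mulf_eq0 (negbTE cn0)/= subr_eq0 => /eqP.
have -> : - `|c| * (T - 2 * `|c| * h) * ((2^-1 - h) ^+ 2 / 2) =
   - (`|c| * (2^-1 - h) ^+ 2) * (T - 2 * `|c| * h) / 2 by ring.
by rewrite E; lra.
Qed.

End optimality.

(** * Existence and uniqueness of the optimal control for each [alpha] *)

Section solution.
Context {R : realType}.
Local Notation mu := (@lebesgue_measure R).

Lemma lipschitz_bounded (f : R -> R) (K t : R) :
  (forall s t, 0 <= s -> s <= t -> t <= 1 -> `|f t - f s| <= K * (t - s)) ->
  0 <= t -> t <= 1 -> `|f t| <= `|f 0| + `|K|.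
Proof.
move=> fK t0 t1; rewrite -[f t](subrK (f 0)) addrC (le_trans (ler_normD _ _))// lerD2l.
apply: (le_trans (fK _ _ _ t0 t1)) => //; rewrite subr0.
by apply: (le_trans (ler_wpM2r t0 (ler_norm K))); rewrite ler_piMr.
Qed.

Lemma control_lipschitz (m c h : R) : 0 <= h ->
  forall s t, 0 <= s -> s <= t -> t <= 1 ->
  `|control m c h t - control m c h s| <= `|c| * (t - s).
Proof.
move=> h0 s t _ st _; rewrite /control opprD addrACA subrr add0r -mulrBr normrM.
rewrite ler_wpM2l// ger0_norm; last by rewrite subr_ge0 clamp_nondecreasing// lerD2r.
by rewrite (le_trans (clamp_lipschitz _ _))// ?lerD2r// opprD addrACA subrr addr0.
Qed.

Lemma admissible_control (s0 sf v0 vf c h : R) : 0 <= h <= 2^-1 ->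
  c * (h / 4 - h ^+ 3 / 3) = (v0 + vf) / 2 - (sf - s0) ->
  admissible s0 sf v0 vf (control (vf - v0) c h).
Proof.
move=> /andP[h0 h1] cD; set m := vf - v0; set u := control m c h.
(* [t + a] and [t + b] vanish at the kinks 1/2 - h and 1/2 + h of [u]. The constant terms below
   enforce the conditions at t = 0. *)
pose a := h - 2^-1; pose b := - h - 2^-1.
(* Antiderivatives of u from (y|y|)' = 2|y| and (|y|^3)' = 3y|y|. *)
pose x2 (t : R) := v0 + m * t +
  c / 4 * ((t + a) * `|t + a| - (t + b) * `|t + b|) - c * h / 2.
pose x1 (t : R) := s0 + v0 * t + m / 2 * (t * t) +
  c / 12 * ((t + a) * ((t + a) * `|t + a|) - (t + b) * ((t + b) * `|t + b|))
  - c * h / 2 * t + c / 12 * (3 * h / 2 + 2 * h ^+ 3).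
have dx2 (t : R) : is_derive t 1 x2 (u t).
  have Da := is_derive_mul_norm_shift a t; have Db := is_derive_mul_norm_shift b t.
  apply: is_derive_eq; rewrite /GRing.scale/= /u /control /clamp.
  rewrite (_ : t - 2^-1 + h = t + a); last by rewrite /a; ring.
  rewrite (_ : t - 2^-1 - h = t + b); last by rewrite /b; ring.
  by field.
have dx1 (t : R) : is_derive t 1 x1 (x2 t).
  have Da := is_derive_norm3_shift a t; have Db := is_derive_norm3_shift b t.
  by apply: is_derive_eq; rewrite /GRing.scale/= /x2; field.
have uL := control_lipschitz m c h0.
(* Lipschitz functions are bounded on [0, 1], so their antiderivatives are Lipschitz: from [u] to
   [x2], then to [x1]. *)
have x2L := is_derive_lipschitz dx2 (fun t => @lipschitz_bounded _ _ t uL).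
have x1L := is_derive_lipschitz dx1 (fun t => @lipschitz_bounded _ _ t x2L).
have a0 : `|a| = - a by rewrite ler0_norm// /a; lra.
have b0 : `|b| = - b by rewrite ler0_norm// /b; lra.
have a1 : `|1 + a| = 1 + a by rewrite ger0_norm// /a; lra.
have b1 : `|1 + b| = 1 + b by rewrite ger0_norm// /b; lra.
split; first exact: lipschitz_absolutely_continuous uL.
exists x1, x2; split.
- by split; [exact: lipschitz_absolutely_continuous x1L
            |exact: lipschitz_absolutely_continuous x2L].
- by move=> t _; exact: is_derive_has_derivative_within.
- by move=> t _; exact: is_derive_has_derivative_within.
- rewrite /x1 !add0r a0 b0 a1 b1; split; first by rewrite /a /b; field.
  (* The end condition on [x1] is the second-moment equation in disguise. *)
  have -> : sf = s0 + v0 + m / 2 - c * (h / 4 - h ^+ 3 / 3) by rewrite cD /m; field.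
  by rewrite /a /b; field.
- rewrite /x2 !add0r a0 b0 a1 b1 /a /b; split; first by field.
  by rewrite /m; field.
Qed.

(* The fourth condition turns the third into an equality unless c = 0, which
   is the degenerate case D = 0; the last one forces h -> 0 as alpha -> oo. *)
Definition optimal_parameters (D alpha c h : R) : Prop :=
  [/\ 0 <= h < 2^-1, c * (h / 4 - h ^+ 3 / 3) = D,
      `|c| * (2^-1 - h) ^+ 2 <= 2 * alpha,
      c * (2 * alpha - `|c| * (2^-1 - h) ^+ 2) = 0
    & h * alpha <= 3 * `|D|].

(** For D != 0, eliminating c = D / g(h) leaves |D| (1/2 - h)^2 = 2 alpha g(h). The difference of
    the two sides is |D| / 4 > 0 at h = 0 and - alpha / 6 < 0 at h = 1/2, so a root lies strictly
    between. *)
Lemma optimal_parameters_exist (D alpha : R) : 0 < alpha ->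
  exists c h, optimal_parameters D alpha c h.
Proof.
move=> alpha0; have [->|D0] := eqVneq D 0.
  exists 0, 0; split; rewrite ?normr0 ?mul0r ?mulr0//.
    by rewrite lexx invr_gt0/=.
  by rewrite mulr_ge0 ?ltW.
pose g (h : R) := h / 4 - h ^+ 3 / 3.
pose f (h : R) := `|D| * ((2^-1 - h) * (2^-1 - h)) - 2 * alpha * (h * 4^-1 - h * h * h * 3^-1).
have fE h : f h = `|D| * (2^-1 - h) ^+ 2 - 2 * alpha * g h by rewrite /f /g; field.
have Dgt0 : 0 < `|D| by rewrite normr_gt0.
have cf : continuous f.
  move=> t; have cid : h @[h --> t] --> t by exact: cvg_id.
  have cc (k : R) : k @[h --> t] --> k by exact: cvg_cst.
  by rewrite /continuous_at /f;
    repeat first [exact: cc | exact: cid | apply: cvgB | apply: cvgM].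
have [|||h h01 fh] := @IVT R f 0 2^-1 0; first by rewrite invr_ge0.
- exact: continuous_subspaceT.
- have f0 : f 0 = `|D| / 4 by rewrite fE /g; field.
  have f1 : f 2^-1 = - (alpha / 6) by rewrite fE /g; field.
  rewrite f0 f1 ge_min le_max; apply/andP; split; apply/orP; [right|left]; lra.
move: h01; rewrite in_itv/= => /andP[h0 h1].
have hn0 : h != 0.
  by apply: contra_eq_neq fh => ->; rewrite fE /g; apply/eqP; lra.
have hn1 : h != 2^-1.
  by apply: contra_eq_neq fh => ->; rewrite fE /g; apply/eqP; lra.
have {hn0}h0 : 0 < h by rewrite lt_neqAle eq_sym hn0.
have {hn1}h1 : h < 2^-1 by rewrite lt_neqAle hn1.
(* From h^2 <= 1/4. This gives g(h) > 0 and, through the root equation, h = O(1/alpha). *)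
have gh : h / 6 <= g h by rewrite /g; nra.
have g0 : 0 < g h by lra.
have cE : `|D / g h| * (2^-1 - h) ^+ 2 = 2 * alpha.
  rewrite normrM normfV (gtr0_norm g0) mulrAC.
  by apply: (canLR (mulfK _)); [rewrite gt_eqF|apply/eqP; rewrite -subr_eq0 -fE fh].
exists (D / g h), h; split; rewrite ?cE ?subrr ?mulr0 ?lexx ?h1 ?(ltW h0)//.
  by rewrite divfK// gt_eqF.
have h2 : (2^-1 - h) ^+ 2 <= 4^-1 by nra.
have Dh : `|D| * (2^-1 - h) ^+ 2 <= `|D| * 4^-1 by rewrite ler_pM2l.
have ag : alpha * (h / 6) <= alpha * g h by rewrite ler_pM2l.
by rewrite fE in fh; lra.
Qed.

Lemma cost_continuous (alpha : R) (w : R -> R) : {within `[0, 1], continuous w} ->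
  cost alpha w = ((2^-1 * \int[mu]_(t in `[0, 1]) w t ^+ 2)%:E
                  + alpha%:E * total_variation 0%R 1%R w)%E.
Proof.
move=> cw; rewrite /cost EFinM fineK//; apply: integrable_fin_num => //.
exact/within_continuous_integrable/within_continuous_sqr.
Qed.

(** The quadratic gap serves twice: its sign gives optimality, its vanishing gives uniqueness. *)
Lemma cost_control_le (s0 sf v0 vf alpha c h : R) (w : R -> R) : 0 < alpha ->
  optimal_parameters ((v0 + vf) / 2 - (sf - s0)) alpha c h ->
  let u := control (vf - v0) c h in
  admissible s0 sf v0 vf w ->
  (cost alpha u + (2^-1 * \int[mu]_(t in `[0, 1]) (w t - u t) ^+ 2)%:E
    <= cost alpha w)%E.
Proof.
move=> alpha0 [/andP[h0 h1] cD ca ca0 _] u adw.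
have h01 : 0 <= h <= 2^-1 by rewrite h0 ltW.
have adu : admissible s0 sf v0 vf u by exact: admissible_control.
have [[acw _] [acu _]] := (adw, adu).
have cw := absolutely_continuous_within acw.
have cu := absolutely_continuous_within acu.
have [[w0 w1] [u0 u1]] := (admissible_moments adw, admissible_moments adu).
rewrite !cost_continuous// total_variation_control//.
have TV0 : (0 <= total_variation 0 1 w)%E by exact: total_variation_ge0.
(* With infinite variation the right side is +oo; splitting here spares a proof that absolutely
   continuous functions have bounded variation. *)
have [TVoo|TVoo] := eqVneq (total_variation 0 1 w) +oo%E.
  by rewrite TVoo mulry gtr0_sg// mul1e addey// leey.
have TVfin : total_variation 0 1 w \is a fin_num.
  by rewrite ge0_fin_numE// lt_neqAle TVoo leey.
rewrite -(fineK TVfin) -!EFinM -!EFinD lee_fin.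
apply: control_minimizes => //; rewrite ?w0 ?w1//.
move=> t t0 t1; rewrite -lee_fin fineK//.
exact: total_variation_reflect.
Qed.

Lemma optimal_control_eq (s0 sf v0 vf alpha c h : R) : 0 < alpha ->
  optimal_parameters ((v0 + vf) / 2 - (sf - s0)) alpha c h ->
  let u := control (vf - v0) c h in
  optimal_control s0 sf v0 vf alpha u /\
  forall w, optimal_control s0 sf v0 vf alpha w ->
    forall t, t \in `[0, 1] -> w t = u t.
Proof.
move=> alpha0 params u.
have [/andP[h0 h1] cD _ _ _] := params.
have h01 : 0 <= h <= 2^-1 by rewrite h0 ltW.
have adu : admissible s0 sf v0 vf u by exact: admissible_control.
have [acu _] := adu; have cu := absolutely_continuous_within acu.
split=> [|w [adw optw] t t01].
  split=> // w /(cost_control_le alpha0 params); apply: le_trans.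
  rewrite leeDl// lee_fin mulr_ge0//; apply: Rintegral_ge0 => t _; exact: sqr_ge0.
have [acw _] := adw; have cw := absolutely_continuous_within acw.
have := le_trans (cost_control_le alpha0 params adw) (optw _ adu).
have cuE : cost alpha u \is a fin_num.
  by rewrite cost_continuous// total_variation_control// -EFinM -EFinD.
(* The finite cost of [u] cancels, leaving a nonpositive integral of a continuous square. *)
rewrite -/u -[leRHS]adde0 leeD2lE// lee_fin => I0.
have phi0 : \int[mu]_(t in `[0, 1]) (w t - u t) ^+ 2 = 0.
  apply/eqP; rewrite eq_le; apply/andP; split; first by lra.
  by apply: Rintegral_ge0 => s _; exact: sqr_ge0.
have := @continuous_Rintegral_eq0 R (fun t => (w t - u t) ^+ 2).
move=> /(_ _ _ phi0 _ t01) H; apply/eqP; rewrite -subr_eq0 -sqrf_eq0 H//.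
  by apply: within_continuous_sqr; exact: within_continuousB.
by move=> s _; exact: sqr_ge0.
Qed.

(** * The limit of large [alpha]: distance to the step control, its variation, convergence *)

Lemma control_u_infty (s0 sf v0 vf alpha c h t : R) :
  let D := (v0 + vf) / 2 - (sf - s0) in
  optimal_parameters D alpha c h -> h <= `|t - 2^-1| -> t != 2^-1 ->
  `|u_infty s0 sf v0 vf t - control (vf - v0) c h t| <= 4 * `|D| * h.
Proof.
move=> D [/andP[h0 h1] cD _ _ _] ht t12.
(* Outside the window |t - 1/2| < h the control is (vf - v0) -+ c h and the limit is (vf - v0) -+ 4
   D, so this is the whole error. It equals (4/3) |c| h^3, compared with |D| = |c| (h/4 - h^3/3). *)
have E : `|4 * D - c * h| <= 4 * `|D| * h.
  have -> : 4 * D - c * h = - (c * (h ^+ 3 * (4 / 3))) by rewrite -cD; field.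
  have g0 : h / 6 <= h / 4 - h ^+ 3 / 3 by nra.
  rewrite normrN -cD !(normrM c) (ger0_norm (_ : 0 <= h ^+ 3 * (4 / 3))); last first.
    by rewrite mulr_ge0// exprn_ge0.
  rewrite (ger0_norm (_ : 0 <= h / 4 - h ^+ 3 / 3)); last by lra.
  have h3 : h ^+ 3 * (4 / 3) <= 4 * h * (h / 6) by nra.
  have -> : 4 * (`|c| * (h / 4 - h ^+ 3 / 3)) * h =
            `|c| * (4 * h * (h / 4 - h ^+ 3 / 3)) by ring.
  by rewrite ler_wpM2l// (le_trans h3)// ler_wpM2l// mulr_ge0.
rewrite /u_infty /control clampE//; move: ht.
have [t0|t0] := ltrP t 2^-1.
  move=> ht; rewrite (_ : t - 2^-1 <= - h); last by lra.
  apply: le_trans E; rewrite -normrN le_eqVlt; apply/orP; left; apply/eqP.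
  by congr `|_|; rewrite /D; field.
move=> ht; have t1 : 2^-1 < t by rewrite lt_neqAle eq_sym t12.
have -> : (if t - 2^-1 <= - h then - h else if t - 2^-1 <= h then t - 2^-1 else h) = h.
  by case: lerP => [?|_]; [lra|]; case: lerP => // ?; lra.
apply: le_trans E; rewrite le_eqVlt; apply/orP; left; apply/eqP.
by congr `|_|; rewrite /D; field.
Qed.

(** A two-valued step is monotone, so its variation is the size of the jump; a downward jump is
    negated first. *)
Lemma total_variation_u_infty (s0 sf v0 vf : R) :
  total_variation 0 1 (u_infty s0 sf v0 vf)
    = (4 * `|2 * (sf - s0) - vf - v0|)%:E.
Proof.
pose step (p q t : R) := if t < 2^-1 then p else q.
have H p q : p <= q -> total_variation 0 1 (step p q) = (q - p)%:E.
  move=> pq; rewrite nondecreasing_total_variation//.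
    by rewrite /step ifF ?ifT// ?invr_gt0//; apply/negbTE; rewrite -leNgt invf_le1// ler1n.
  move=> x y _ _ xy; rewrite /step; case: ifPn => hx; case: ifPn => hy //.
  by rewrite (le_lt_trans xy hy) in hx.
set p := 4 * (sf - s0) - vf - 3 * v0; set q := 3 * vf + v0 - 4 * (sf - s0).
rewrite -[u_infty _ _ _ _]/(step p q).
have [pq|pq] := lerP p q.
  rewrite H//; congr (_%:E); rewrite ler0_norm; rewrite /p /q in pq *; lra.
rewrite -total_variationN (_ : (\- _) = step (- p) (- q)); last first.
  by apply/funext => t; rewrite /step/=; case: ifP.
rewrite H ?lerN2 ?ltW//; congr (_%:E); rewrite gtr0_norm; rewrite /p /q in pq *; lra.
Qed.

Lemma optimal_controls_cvg (s0 sf v0 vf : R) (u : R -> R -> R) (t : R) :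
  (forall alpha, 0 < alpha -> optimal_control s0 sf v0 vf alpha (u alpha)) ->
  t \in `[0, 1] -> t != 2^-1 ->
  u alpha t @[alpha --> +oo] --> u_infty s0 sf v0 vf t.
Proof.
move=> optu t01 t12; apply/cvgrPdist_le => e e0.
pose D := (v0 + vf) / 2 - (sf - s0).
have y0 : 0 < `|t - 2^-1| by rewrite normr_gt0 subr_eq0.
near=> alpha.
have alpha0 : 0 < alpha by near: alpha; apply: nbhs_pinfty_gt; exact: num_real.
(* Since h <= 3 |D| / alpha, this threshold puts [t] outside the switching window and the next makes
   the error 4 |D| h at most [e]. *)
have alpha1 : 3 * `|D| / `|t - 2^-1| < alpha by near: alpha; apply: nbhs_pinfty_gt; exact: num_real.
have alpha2 : 12 * `|D| ^+ 2 / e < alpha by near: alpha; apply: nbhs_pinfty_gt; exact: num_real.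
have [c [h params]] := optimal_parameters_exist D alpha0.
have [_ /(_ _ (optu _ alpha0) _ t01) ->] := optimal_control_eq alpha0 params.
have [/andP[h0 h1] _ _ _ hD] := params.
rewrite ltr_pdivrMr// in alpha1; rewrite ltr_pdivrMr// in alpha2.
have hle : h <= `|t - 2^-1|.
  by rewrite -(ler_pM2r alpha0) (le_trans hD)// [leRHS]mulrC ltW.
apply: (le_trans (control_u_infty params hle t12)).
rewrite -(ler_pM2r alpha0).
have : 4 * `|D| * (h * alpha) <= 4 * `|D| * (3 * `|D|) by rewrite ler_wpM2l// mulr_ge0.
by lra.
Unshelve. all: by end_near. Qed.

End solution.

Theorem theorem2 (R : realType) (s0 sf v0 vf : R) :
  (forall alpha : R, 0 < alpha ->
     exists u : R -> R, optimal_control s0 sf v0 vf alpha u /\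
       forall w : R -> R, optimal_control s0 sf v0 vf alpha w ->
         forall t : R, t \in `[0, 1] -> w t = u t) /\
  (forall u : R -> R -> R,
     (forall alpha : R, 0 < alpha -> optimal_control s0 sf v0 vf alpha (u alpha)) ->
     (forall t : R, t \in `[0, 1] -> t != 2^-1 ->
        u alpha t @[alpha --> +oo] --> u_infty s0 sf v0 vf t) /\
     (forall w : R -> R,
        (forall t : R, t \in `[0, 1] -> t != 2^-1 ->
           u alpha t @[alpha --> +oo] --> w t) ->
        forall t : R, t \in `[0, 1] -> t != 2^-1 -> w t = u_infty s0 sf v0 vf t)) /\
  total_variation 0 1 (u_infty s0 sf v0 vf)
    = (4 * `|2 * (sf - s0) - vf - v0|)%:E.
Proof.
split.
  move=> alpha alpha0.
  have [c [h params]] := optimal_parameters_exist ((v0 + vf) / 2 - (sf - s0)) alpha0.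
  exists (control (vf - v0) c h); exact: optimal_control_eq.
split; last exact: total_variation_u_infty.
move=> u optu; split=> [t t01 t12|w uw t t01 t12]; first exact: optimal_controls_cvg.
transitivity (lim (u alpha t @[alpha --> +oo])).
  by apply/esym/cvg_lim => //; exact: uw.
by apply/cvg_lim => //; exact: optimal_controls_cvg.
Qed.
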